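(* There is a universal constant $C>0$ such that the following holds. Let $\ell\ge2$, let $\kappa\in\mathbb{N}_+^\ell$ with $\kappa_1+\cdots+\kappa_\ell=n$, and write $p_i=\kappa_i/n$. Let $f:\mathcal{U}_\kappa\to\{0,1\}$ be such that $\mathrm{Inf}[f]\le Kn$. Then for every $\epsilon>0$ there exists $h:\mathcal{U}_\kappa\to\{0,1\}$ depending on at most $\left(\frac{1}{p_1p_2\cdots p_\ell}\right)^{CK/\epsilon}$ coordinates such that $\Pr_{u\sim\pi_\kappa}[f(u)\ne h(u)]\le\epsilon$.
   Context: The multislice is $\mathcal{U}_\kappa=\{u\in[\ell]^n : u \text{ has exactly } \kappa_i \text{ coordinates equal to } i,\ \forall i\in[\ell]\}$, with uniform distribution $\pi_\kappa$. $S_n$ acts by $(u^\sigma)_j=u_{\sigma(j)}$; $\mathrm{Trans}(n)$ is the set of all transpositions in $S_n$. For $f:\mathcal{U}_\kappa\to\mathbb{R}$, $\mathrm{Inf}_\tau[f]=\tfrac12\mathbf{E}_{u\sim\pi_\kappa}[(f(u)-f(u^\tau))^2]$ and the total influence is $\mathrm{Inf}[f]=\sum_{\tau\in\mathrm{Trans}(n)}\mathrm{Inf}_\tau[f]$. A function $h$ on $\mathcal{U}_\kappa$ depends on at most $m$ coordinates if there is $J\subseteq[n]$ with $|J|\le m$ such that $h(u)$ is determined by $(u_j)_{j\in J}$. *)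

(* Defs.v *)
From HB Require Import structures.
From mathcomp Require Import all_boot all_order all_algebra all_fingroup.
From mathcomp Require Import reals exp.

Set Implicit Arguments.
Unset Strict Implicit.
Unset Printing Implicit Defensive.

Import Order.TTheory GRing.Theory Num.Theory.

Local Open Scope ring_scope.

(* The symbols [l] are numbered from 0, i.e. taken in 'I_l. *)
Definition in_multislice (n l : nat) (kappa : 'I_l -> nat) :
    pred {ffun 'I_n -> 'I_l} :=
  fun u => [forall i, #|[set j | u j == i]| == kappa i].

Definition multislice (n l : nat) (kappa : 'I_l -> nat) : Type :=
  {u : {ffun 'I_n -> 'I_l} | in_multislice kappa u}.

HB.instance Definition _ (n l : nat) (kappa : 'I_l -> nat) :=
  SubFinite.on (multislice n kappa).

Lemma in_multislice_perm (n l : nat) (kappa : 'I_l -> nat) (s : 'S_n)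
    (u : multislice n kappa) :
  in_multislice kappa [ffun j => val u (s j)].
Proof.
apply/forallP => i; have /forallP/(_ i)/eqP <- := valP u.
rewrite -(card_preimset [set j | val u j == i] (@perm_inj _ s)).
by apply/eqP; apply: eq_card => j; rewrite !inE ffunE.
Qed.

Definition multislice_perm (n l : nat) (kappa : 'I_l -> nat)
    (u : multislice n kappa) (s : 'S_n) : multislice n kappa :=
  Sub [ffun j => val u (s j)] (in_multislice_perm s u).

Definition transpositions (n : nat) : {set 'S_n} :=
  [set s | [exists i, exists j, (i != j) && (s == tperm i j)]].

(* Expectation and probability under the uniform distribution on T. *)
Definition uexpect (R : realType) (T : finType) (g : T -> R) : R :=
  (\sum_(u : T) g u) / #|T|%:R.

Definition uprob (R : realType) (T : finType) (A : pred T) : R :=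
  uexpect (fun u => (A u)%:R : R).

Definition influence (R : realType) (n l : nat) (kappa : 'I_l -> nat)
    (f : multislice n kappa -> R) (s : 'S_n) : R :=
  2^-1 * uexpect (fun u => (f u - f (multislice_perm u s)) ^+ 2).

Definition total_influence (R : realType) (n l : nat) (kappa : 'I_l -> nat)
    (f : multislice n kappa -> R) : R :=
  \sum_(s in transpositions n) influence f s.

Definition depends_on_at_most (R : realType) (n l : nat) (kappa : 'I_l -> nat)
    (A : Type) (h : multislice n kappa -> A) (m : R) : Prop :=
  exists2 J : {set 'I_n}, #|J|%:R <= m &
    forall u v : multislice n kappa,
      (forall j, j \in J -> val u j = val v j) -> h u = h v.

(* Main.v *)
(** For a set [S] of positions let [E_S] be the average over the permutations
of [S], that is, the conditional expectation given the coordinates outside [S].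

A log-Sobolev inequality [Ent (g^2) <= O(L / n) * sum_(a, b) E (g - g^(a b))^2]
with [L = ln (1 / (p_1 ... p_l))] follows by induction on [S]: the entropy
splits along the color revealed at a position [j], and one averages over [j].
The entropy of the revealed color is controlled by the log-Sobolev inequality
of a finite space, whose constant is logarithmic in the inverse color
frequencies.

Revealing coordinates one at a time, in order of decreasing influence, gives
martingale differences [d_j = E_(S - j) f - E_S f]. As the sum of all
transpositions is central, the Dirichlet forms of the [d_j] add up to at most
that of [f], so the inequality applied to each [d_j] bounds the sum of the
[Ent (d_j^2)] (the method of Falik and Samorodnitsky). On the other hand
[Ent (d^2) >= |d|_2^2 (1 + ln t) - t |d|_1^2], and [|d_j|_1] is at most three
times the influence of [j]. If [S] is the set of positions of influence at most
[exp (- O(K L / eps))], this forces [E (f - E_S f)^2 <= eps / 4], and [h] is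
obtained by rounding [E_S f]; there are few positions outside [S] because the
influences sum to [O(K)]. *)

Require Import Defs.
From HB Require Import structures.
From mathcomp Require Import all_boot all_order all_algebra all_fingroup.
From mathcomp Require Import reals sequences exp.
From mathcomp Require Import ring lra.

Set Implicit Arguments.
Unset Strict Implicit.
Unset Printing Implicit Defensive.

Import Order.TTheory GRing.Theory Num.Theory.

Local Open Scope ring_scope.

(** * Entropy inequalities for real functions on a finite set *)

Lemma ln_le_sub1 (R : realType) (x : R) : 0 < x -> ln x <= x - 1.
Proof.
move=> x0; have h : -1 < x - 1 by lra.
by have := le_ln1Dx h; rewrite addrC subrK.
Qed.

Lemma ln_ge_1subV (R : realType) (x : R) : 0 < x -> 1 - x^-1 <= ln x.
Proof.
move=> x0; have xV : 0 < x^-1 by rewrite invr_gt0.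
have := ln_le_sub1 xV; rewrite lnV ?posrE //; lra.
Qed.

(* With [t = x / m] this is [2 t^2 ln t - t^2 + 1 <= (5 + 8 ln T) (t - 1)^2]
   for [t <= T]: use [ln t <= t - 1] if [t <= 2], and [t <= 2 (t - 1)] if
   [2 <= t]. *)
Lemma sqr_entropy_le (R : realType) (T x m : R) :
  1 <= T -> 0 < m -> 0 <= x -> x <= T * m ->
  x ^+ 2 * ln (x ^+ 2) - x ^+ 2 * ln (m ^+ 2) - x ^+ 2 + m ^+ 2
    <= (5 + 8 * ln T) * (x - m) ^+ 2.
Proof.
move=> T1 m0 x0 xT.
have lT0 := ln_ge0 T1.
have [->|xn0] := eqVneq x 0.
  by rewrite expr0n /= !mul0r !subr0 !add0r; nra.
have xp : 0 < x by rewrite lt_def xn0.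
rewrite !lnXn //.
set t := x / m.
have tp : 0 < t by rewrite divr_gt0.
have xE : x = t * m by rewrite /t divfK // gt_eqF.
have tT : t <= T by rewrite /t ler_pdivrMr.
have -> : ln x = ln t + ln m by rewrite xE lnM ?posrE.
have key : 2 * t ^+ 2 * ln t - t ^+ 2 + 1 <= (5 + 8 * ln T) * (t - 1) ^+ 2.
  have [t2|t2] := lerP t 2.
    have := ln_le_sub1 tp => h.
    have : 2 * t ^+ 2 * ln t <= 2 * t ^+ 2 * (t - 1).
      by rewrite ler_wpM2l // mulr_ge0 // sqr_ge0.
    have : 0 <= ln T * (t - 1) ^+ 2 by rewrite mulr_ge0 // sqr_ge0.
    have : 0 <= (2 - t) * (t - 1) ^+ 2 by rewrite mulr_ge0 ?sqr_ge0 // subr_ge0.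
    nra.
  have lt : ln t <= ln T by rewrite ler_ln ?posrE // (lt_le_trans _ T1).
  have : t ^+ 2 * ln t <= t ^+ 2 * ln T by rewrite ler_wpM2l // sqr_ge0.
  have : 0 <= ln T * (4 * (t - 1) ^+ 2 - t ^+ 2) by rewrite mulr_ge0 //; nra.
  nra.
have -> : x ^+ 2 * ((ln t + ln m) *+ 2) - x ^+ 2 * (ln m *+ 2) - x ^+ 2 + m ^+ 2
   = m ^+ 2 * (2 * t ^+ 2 * ln t - t ^+ 2 + 1) by rewrite xE; ring.
have -> : (5 + 8 * ln T) * (x - m) ^+ 2 = m ^+ 2 * ((5 + 8 * ln T) * (t - 1) ^+ 2).
  by rewrite xE; ring.
by rewrite ler_wpM2l // sqr_ge0.
Qed.

Lemma sum_sqr_sub (R : realType) (I : finType) (A : {set I}) (F : I -> R) :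
  \sum_(i in A) \sum_(j in A) (F i - F j) ^+ 2 =
  2 * (#|A|%:R * \sum_(i in A) F i ^+ 2 - (\sum_(i in A) F i) ^+ 2).
Proof.
have -> : \sum_(i in A) \sum_(j in A) (F i - F j) ^+ 2 =
  \sum_(i in A) (#|A|%:R * F i ^+ 2 + \sum_(j in A) F j ^+ 2
     - 2 * F i * \sum_(j in A) F j).
  apply: eq_bigr => i _.
  rewrite mulr_sumr mulr_natl -sumr_const -big_split -sumrB /=.
  by apply: eq_bigr => j _; ring.
rewrite sumrB big_split /= sumr_const -mulr_sumr -mulr_suml -mulr_sumr.
by rewrite -[_ *+ _]mulr_natl; ring.
Qed.

(** Log-Sobolev inequality of a finite uniform space. Bounding [a * ln a] below by the tangent of
    [x * ln x] at [m ^+ 2] turns the entropy into a mean of the pointwise expressions of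
    [sqr_entropy_le], whose right sides add up to a multiple of the variance. The cap [T] on the
    ratio of [F] to its mean enters through [ln T]. *)
Lemma sqr_entropy_mean_le (R : realType) (I : finType) (A : {set I}) (F : I -> R)
    (T : R) :
  (0 < #|A|)%N -> 1 <= T -> (forall i, i \in A -> 0 <= F i) ->
  (forall i, i \in A -> F i <= T * ((\sum_(j in A) F j) / #|A|%:R)) ->
  (\sum_(i in A) F i ^+ 2 * ln (F i ^+ 2)) / #|A|%:R
    - (\sum_(i in A) F i ^+ 2) / #|A|%:R * ln ((\sum_(i in A) F i ^+ 2) / #|A|%:R) <=
  (5 + 8 * ln T) / (2 * #|A|%:R ^+ 2) *
    \sum_(i in A) \sum_(j in A) (F i - F j) ^+ 2.
Proof.
move=> A0 T1 F0; set N : R := #|A|%:R; set m := _ / N => FT.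
set a := (\sum_(i in A) F i ^+ 2) / N.
have N0 : 0 < N by rewrite ltr0n.
have mge0 : 0 <= m by rewrite divr_ge0 ?ler0n // sumr_ge0.
have lT0 := ln_ge0 T1.
have rhs0 : 0 <= (5 + 8 * ln T) / (2 * N ^+ 2) *
    \sum_(i in A) \sum_(j in A) (F i - F j) ^+ 2.
  apply: mulr_ge0; last by apply: sumr_ge0 => i _; apply: sumr_ge0 => j _; exact: sqr_ge0.
  by apply: divr_ge0; [lra | rewrite mulr_ge0 // exprn_ge0 // ltW].
have [m0|mn0] := eqVneq m 0.
  have FF i : i \in A -> F i = 0.
    by move=> iA; apply/eqP; rewrite eq_le F0 // andbT (le_trans (FT _ iA)) // m0 mulr0.
  have -> : a = 0 by rewrite /a big1 ?mul0r // => i iA; rewrite FF // expr0n.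
  by rewrite big1 ?mul0r ?subr0 // => i iA; rewrite FF // expr0n /= mul0r.
have mp : 0 < m by rewrite lt_def mn0.
have ap : 0 < a.
  rewrite /a divr_gt0 // lt_def sumr_ge0 ?andbT; last by move=> i _; exact: sqr_ge0.
  apply: contraNneq mn0 => s0; rewrite /m big1 ?mul0r // => i iA; apply/eqP.
  rewrite -sqrf_eq0; apply/eqP.
  by apply: (psumr_eq0P (P := mem A) (F := fun i => F i ^+ 2)) s0 _ iA => j _; exact: sqr_ge0.
have step1 : a * ln (m ^+ 2) + a - m ^+ 2 <= a * ln a.
  have m2 : 0 < m ^+ 2 by rewrite exprn_gt0.
  have := ln_ge_1subV (divr_gt0 ap m2).
  rewrite ln_div ?posrE // invf_div => h.
  have : a * (1 - m ^+ 2 / a) <= a * (ln a - ln (m ^+ 2)) by rewrite ler_wpM2l // ltW.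
  by rewrite [a * (1 - _)]mulrBr mulr1 mulrCA divff ?gt_eqF //; lra.
have step2 : \sum_(i in A) F i ^+ 2 * ln (F i ^+ 2) <=
   \sum_(i in A) (F i ^+ 2 * ln (m ^+ 2) + F i ^+ 2 - m ^+ 2
       + (5 + 8 * ln T) * (F i - m) ^+ 2).
  apply: ler_sum => i iA.
  by have := sqr_entropy_le T1 mp (F0 _ iA) (FT _ iA); lra.
have sF : \sum_(i in A) F i = N * m by rewrite /m mulrC divfK // gt_eqF.
have sF2 : \sum_(i in A) F i ^+ 2 = N * a by rewrite /a mulrC divfK // gt_eqF.
have var : \sum_(i in A) (F i - m) ^+ 2 = N * (a - m ^+ 2).
  rewrite (eq_bigr (fun i => F i ^+ 2 + (- 2 * m * F i + m ^+ 2))); last first.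
    by move=> i _; ring.
  by rewrite !big_split /= -mulr_sumr sumr_const sF sF2 -[_ *+ _]mulr_natl -/N; ring.
rewrite !big_split /= -mulr_suml sumr_const -mulr_sumr var sF2 mulNrn in step2.
rewrite -[_ *+ _]mulr_natl -/N in step2.
rewrite sum_sqr_sub sF sF2 -/N.
have -> : (5 + 8 * ln T) / (2 * N ^+ 2) * (2 * (N * (N * a) - (N * m) ^+ 2)) =
  (5 + 8 * ln T) * (a - m ^+ 2).
  by field; rewrite gt_eqF.
have : (\sum_(i in A) F i ^+ 2 * ln (F i ^+ 2)) / N <=
   a * ln (m ^+ 2) + a - m ^+ 2 + (5 + 8 * ln T) * (a - m ^+ 2).
  rewrite ler_pdivrMr //; apply: le_trans step2 _.
  by rewrite le_eqVlt; apply/orP; left; apply/eqP; ring.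
lra.
Qed.

Lemma sum_mul_le_sqrt (R : realType) (I : finType) (A : {pred I}) (a b : I -> R) :
  \sum_(i in A) a i * b i <=
  Num.sqrt (\sum_(i in A) a i ^+ 2) * Num.sqrt (\sum_(i in A) b i ^+ 2).
Proof.
set x := Num.sqrt (\sum_(i in A) a i ^+ 2).
set y := Num.sqrt (\sum_(i in A) b i ^+ 2).
have sa0 : 0 <= \sum_(i in A) a i ^+ 2 by apply: sumr_ge0 => i _; exact: sqr_ge0.
have sb0 : 0 <= \sum_(i in A) b i ^+ 2 by apply: sumr_ge0 => i _; exact: sqr_ge0.
have x2 : x ^+ 2 = \sum_(i in A) a i ^+ 2 by rewrite sqr_sqrtr.
have y2 : y ^+ 2 = \sum_(i in A) b i ^+ 2 by rewrite sqr_sqrtr.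
have x0 : 0 <= x := sqrtr_ge0 _.
have y0 : 0 <= y := sqrtr_ge0 _.
have zero (c : I -> R) : \sum_(i in A) c i ^+ 2 = 0 -> forall i, i \in A -> c i = 0.
  move=> s0 i iA; apply/eqP; rewrite -sqrf_eq0; apply/eqP.
  by apply: (psumr_eq0P (P := A) (F := fun i => c i ^+ 2)) s0 _ iA => j _; exact: sqr_ge0.
have [xz|xn] := eqVneq x 0.
  rewrite big1 ?mulr_ge0 // => i iA; rewrite (zero a _ _ iA) ?mul0r //.
  by rewrite -x2 xz expr0n.
have [yz|yn] := eqVneq y 0.
  rewrite big1 ?mulr_ge0 // => i iA; rewrite (zero b _ _ iA) ?mulr0 //.
  by rewrite -y2 yz expr0n.
have xp : 0 < x by rewrite lt_def xn.
have yp : 0 < y by rewrite lt_def yn.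
have : 0 <= \sum_(i in A) (y * a i - x * b i) ^+ 2 by apply: sumr_ge0 => i _; exact: sqr_ge0.
rewrite (eq_bigr (fun i => y ^+ 2 * a i ^+ 2
    + (x ^+ 2 * b i ^+ 2 + (- 2 * (x * y)) * (a i * b i)))); last first.
  by move=> i _; ring.
rewrite !big_split /= -!mulr_sumr -x2 -y2 => h.
have xyp : 0 < x * y by rewrite mulr_gt0.
rewrite -(ler_pM2l xyp); nra.
Qed.

(** The triangle inequality of the Euclidean norm, squared; it lets square roots of second moments
    be compared term by term. *)
Lemma sqr_sub_sqrt_sum_le (R : realType) (I : finType) (A : {pred I})
    (a b : I -> R) :
  (Num.sqrt (\sum_(i in A) a i ^+ 2) - Num.sqrt (\sum_(i in A) b i ^+ 2)) ^+ 2
    <= \sum_(i in A) (a i - b i) ^+ 2.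
Proof.
have sa0 : 0 <= \sum_(i in A) a i ^+ 2 by apply: sumr_ge0 => i _; exact: sqr_ge0.
have sb0 : 0 <= \sum_(i in A) b i ^+ 2 by apply: sumr_ge0 => i _; exact: sqr_ge0.
rewrite sqrrB !sqr_sqrtr //.
rewrite [leRHS](eq_bigr (fun i => a i ^+ 2 + b i ^+ 2 + (- 2) * (a i * b i))); last first.
  by move=> i _; ring.
rewrite !big_split /= -mulr_sumr.
by have := sum_mul_le_sqrt A a b; lra.
Qed.

(** Averaging a pointwise tangent bound shows that the entropy is at least [a * ln (a / b ^+ 2)].
    The bound [ln y >= 1 - 1 / y] at [y = a / (t * b ^+ 2)] then trades this logarithm for the free
    parameter [t]. *)
Lemma entropy_sqr_ge (R : realType) (T : finType) (g : T -> R) (t : R) :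
  (0 < #|T|)%N -> 0 < t ->
  uexpect (fun u => g u ^+ 2) * (1 + ln t) - t * uexpect (fun u => `|g u|) ^+ 2 <=
  uexpect (fun u => g u ^+ 2 * ln (g u ^+ 2))
    - uexpect (fun u => g u ^+ 2) * ln (uexpect (fun u => g u ^+ 2)).
Proof.
move=> T0 t0; set a := uexpect (fun u => g u ^+ 2); set b := uexpect (fun u => `|g u|).
have N0 : (0 : R) < #|T|%:R by rewrite ltr0n.
have b0 : 0 <= b by rewrite /b /uexpect divr_ge0 ?ler0n // sumr_ge0.
have a0 : 0 <= a by rewrite /a /uexpect divr_ge0 ?ler0n // sumr_ge0 // => u _; exact: sqr_ge0.
have [az|an] := eqVneq a 0.
  have g0 u : g u = 0.
    apply/eqP; rewrite -sqrf_eq0; apply/eqP.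
    apply: (psumr_eq0P (P := predT) (F := fun i => g i ^+ 2)) => // [j _|].
      exact: sqr_ge0.
    by move: az => /eqP; rewrite mulf_eq0 invr_eq0 (gt_eqF N0) orbF => /eqP.
  have -> : b = 0 by rewrite /b /uexpect big1 ?mul0r // => u _; rewrite g0 normr0.
  have -> : uexpect (fun u => g u ^+ 2 * ln (g u ^+ 2)) = 0.
    by rewrite /uexpect big1 ?mul0r // => u _; rewrite g0 expr0n /= mul0r.
  by rewrite az !mul0r expr0n /= mulr0 subr0.
have ap : 0 < a by rewrite lt_def an.
have bp : 0 < b.
  rewrite lt_def b0 andbT; apply: contraNneq an => bz.
  rewrite /a /uexpect big1 ?mul0r // => u _; apply/eqP; rewrite sqrf_eq0 -normr_eq0; apply/eqP.
  apply: (psumr_eq0P (P := predT) (F := fun i => `|g i|)) => //.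
  by move: bz => /eqP; rewrite mulf_eq0 invr_eq0 (gt_eqF N0) orbF => /eqP.
(* With this choice [2 * a - 2 * c * b] vanishes when the pointwise bound is averaged. *)
set c := a / b.
have cp : 0 < c by rewrite divr_gt0.
have pt u : (2 * ln c + 2) * g u ^+ 2 - 2 * c * `|g u| <= g u ^+ 2 * ln (g u ^+ 2).
  have -> : g u ^+ 2 = `|g u| ^+ 2 by rewrite real_normK // num_real.
  have := normr_ge0 (g u); set y := `|g u|.
  rewrite le_eqVlt => /orP[/eqP <-|yp]; first by rewrite expr0n /= !mulr0 mul0r subr0.
  rewrite lnXn //.
  have := ln_ge_1subV (divr_gt0 yp cp); rewrite ln_div ?posrE // invf_div => h.
  have : y ^+ 2 * (1 - c / y) <= y ^+ 2 * (ln y - ln c) by rewrite ler_wpM2l // sqr_ge0.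
  have -> : y ^+ 2 * (1 - c / y) = y ^+ 2 - c * y by field; rewrite gt_eqF.
  lra.
have mean (x y : R) : (forall u, x * g u ^+ 2 - y * `|g u| <= g u ^+ 2 * ln (g u ^+ 2)) ->
    x * a - y * b <= uexpect (fun u => g u ^+ 2 * ln (g u ^+ 2)).
  move=> h; rewrite /a /b /uexpect !mulrA -mulrBl ler_pM2r ?invr_gt0 // !mulr_sumr -sumrB.
  by apply: ler_sum => u _.
have s1 := mean _ _ pt.
have cb : c * b = a by rewrite /c divfK // gt_eqF.
have tb : 0 < t * b ^+ 2 by rewrite mulr_gt0 // exprn_gt0.
have := ln_ge_1subV (divr_gt0 ap tb).
rewrite invf_div ln_div ?posrE // lnM ?posrE ?exprn_gt0 // lnXn // => h.
have : a * (1 - t * b ^+ 2 / a) <= a * (ln a - (ln t + ln b *+ 2)) by rewrite ler_wpM2l.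
have -> : a * (1 - t * b ^+ 2 / a) = a - t * b ^+ 2 by field.
have lc : ln c = ln a - ln b by rewrite /c ln_div ?posrE.
move: s1; rewrite -mulrA cb lc; lra.
Qed.

(** * Averages over the permutations of a set of positions *)

Section SymmetricAverage.

Variables (R : realType) (n l : nat) (kappa : 'I_l -> nat).

Local Notation X := (multislice n kappa).
Local Notation "u ## s" := (multislice_perm u s%g) (at level 25, left associativity).

Implicit Types (S : {set 'I_n}) (u v : X) (s t : 'S_n) (g h : X -> R).

Lemma multislice_perm1 u : u ## 1 = u.
Proof. by apply/val_inj/ffunP => j; rewrite ffunE perm1. Qed.

Lemma multislice_permM u s t : u ## (s * t) = u ## t ## s.
Proof. by apply/val_inj/ffunP => j; rewrite !ffunE permM. Qed.

Lemma multislice_permK s : cancel (fun u => u ## s) (fun u => u ## s^-1).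
Proof. by move=> u; rewrite -multislice_permM mulVg multislice_perm1. Qed.

Lemma mem_Sym S s : reflect (forall x, x \notin S -> s x = x) (s \in Sym S).
Proof.
rewrite inE; apply: (iffP subsetP) => h x.
  by apply: contraNeq => sx; apply: h; rewrite inE.
by rewrite inE; apply: contraNT => /h ->.
Qed.

Lemma tperm_Sym S x y : x \in S -> y \in S -> tperm x y \in Sym S.
Proof.
move=> xS yS; apply/mem_Sym => z zS; rewrite tpermD //.
  by apply: contraNneq zS => <-.
by apply: contraNneq zS => <-.
Qed.

Lemma SymS S S' : S' \subset S -> Sym S' \subset Sym S.
Proof.
move=> /subsetP sub; apply/subsetP => s /mem_Sym h; apply/mem_Sym => x xS.
by apply: h; apply: contra xS; apply: sub.
Qed.

Lemma Sym_closed S s x : s \in Sym S -> (s x \in S) = (x \in S).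
Proof. by rewrite inE => /perm_closed. Qed.

(* The conditional expectation of [g] given the coordinates outside [S]. *)
Definition symavg S g u : R := (\sum_(s in Sym S) g (u ## s)) / #|Sym S|%:R.

Lemma card_Sym_gt0 S : 0 < #|Sym S|%:R :> R.
Proof. by rewrite ltr0n card_Sym fact_gt0. Qed.

Lemma symavg_perm S g u s : s \in Sym S -> symavg S g (u ## s) = symavg S g u.
Proof.
move=> sS; rewrite /symavg; congr (_ / _).
rewrite [RHS](reindex_inj (mulIg s)) /=.
apply: eq_big => [t|t _]; first by rewrite groupMr.
by rewrite multislice_permM.
Qed.

Lemma eq_symavg S g h u :
  (forall s, s \in Sym S -> g (u ## s) = h (u ## s)) -> symavg S g u = symavg S h u.
Proof. by move=> gh; rewrite /symavg; congr (_ / _); apply: eq_bigr. Qed.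

Lemma symavgM S (r : X -> R) g u :
  (forall s, s \in Sym S -> r (u ## s) = r u) ->
  symavg S (fun v => r v * g v) u = r u * symavg S g u.
Proof.
move=> ru; rewrite /symavg mulrA mulr_sumr; congr (_ / _).
by apply: eq_bigr => s sS; rewrite ru.
Qed.

Lemma symavg_cst S (c : R) u : symavg S (fun=> c) u = c.
Proof.
by rewrite /symavg sumr_const -[_ *+ _]mulr_natr mulfK // gt_eqF // card_Sym_gt0.
Qed.

Lemma symavg_id S g u :
  (forall s, s \in Sym S -> g (u ## s) = g u) -> symavg S g u = g u.
Proof. by move=> gu; rewrite (eq_symavg (h := fun=> g u)) ?symavg_cst. Qed.

Lemma symavg_sum S (I : finType) (A : {pred I}) (G : I -> X -> R) u :
  symavg S (fun v => \sum_(i in A) G i v) u = \sum_(i in A) symavg S (G i) u.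
Proof. by rewrite /symavg exchange_big /= mulr_suml. Qed.

Lemma ler_symavg S g h u :
  (forall s, s \in Sym S -> g (u ## s) <= h (u ## s)) ->
  symavg S g u <= symavg S h u.
Proof.
by move=> gh; rewrite /symavg ler_pM2r ?invr_gt0 ?card_Sym_gt0 //; apply: ler_sum.
Qed.

Lemma symavg_ge0 S g u : (forall v, 0 <= g v) -> 0 <= symavg S g u.
Proof. by move=> g0; rewrite divr_ge0 ?ler0n // sumr_ge0. Qed.

Lemma symavg_set0 g u : symavg set0 g u = g u.
Proof.
apply: symavg_id => s /mem_Sym s1; suff -> : s = 1%g by rewrite multislice_perm1.
by apply/permP => x; rewrite perm1 s1 // inE.
Qed.

(** Right multiplication by [tperm j k] carries the stabilizer of [j] onto the permutations sending
    [j] to [k]. *)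
Lemma sum_Sym_fiber S j k (F : 'S_n -> R) : j \in S -> k \in S ->
  \sum_(s in Sym S | s j == k) F s =
  \sum_(t in Sym (S :\ j)) F (t * tperm j k)%g.
Proof.
move=> jS kS; rewrite (reindex_inj (mulIg (tperm j k))) /=.
apply: eq_bigl => t; rewrite groupMr ?tperm_Sym // permM.
rewrite -{2}(tpermL j k) (inj_eq perm_inj).
apply/andP/idP => [[/mem_Sym tS /eqP tj]|tSj].
  by apply/mem_Sym => x; rewrite !inE negb_and negbK => /orP[/eqP->|/tS].
split; first by apply: (subsetP (SymS (subsetDl S [set j]))).
by apply/eqP; move/mem_Sym: tSj; apply; rewrite !inE eqxx.
Qed.

Lemma card_Sym_setD1 S j : j \in S ->
  #|Sym S|%:R = #|S|%:R * #|Sym (S :\ j)|%:R :> R.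
Proof.
move=> jS; rewrite !card_Sym -natrM [#|S|](cardsD1 j S) jS /= factS.
by rewrite add1n.
Qed.

Lemma symavg_fiber S j k g u : j \in S -> k \in S ->
  symavg (S :\ j) g (u ## tperm j k) =
  (\sum_(s in Sym S | s j == k) g (u ## s)) / #|Sym (S :\ j)|%:R.
Proof.
move=> jS kS; rewrite sum_Sym_fiber // /symavg; congr (_ / _).
by apply: eq_bigr => t _; rewrite multislice_permM.
Qed.

(** The image of [j] under a uniform permutation of [S] is uniform, and [u ## tperm j k] has at [j]
    the color that [u] has at [k]: revealing the color at [j] amounts to drawing [k] from [S]. *)
Lemma symavg_setD1 S j g u : j \in S ->
  symavg S g u =
  (\sum_(k in S) symavg (S :\ j) g (u ## tperm j k)) / #|S|%:R.
Proof.
move=> jS.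
rewrite (eq_bigr (fun k => (\sum_(s in Sym S | s j == k) g (u ## s)) / #|Sym (S :\ j)|%:R)); last first.
  by move=> k kS; rewrite symavg_fiber.
rewrite -mulr_suml -mulrA -invfM mulrC [_ * #|S|%:R]mulrC -card_Sym_setD1 // mulrC /symavg; congr (_ / _).
rewrite (partition_big (fun s : 'S_n => s j) (mem S)) //= => s sS.
by rewrite Sym_closed.
Qed.

(** Tower property: an element of [Sym S'] is absorbed by a change of variable in the sum over
    [Sym S]. *)
Lemma symavg_symavg_sub S S' g u : S' \subset S ->
  symavg S (symavg S' g) u = symavg S g u.
Proof.
move=> sub; rewrite {1}/symavg.
rewrite (eq_bigr (fun s => (\sum_(t in Sym S') g (u ## s ## t)) / #|Sym S'|%:R)) //.
rewrite -mulr_suml exchange_big /=.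
rewrite (eq_bigr (fun=> symavg S g u * #|Sym S|%:R)); last first.
  move=> t tS'; rewrite /symavg divfK ?gt_eqF ?card_Sym_gt0 //.
  rewrite [RHS](reindex_inj (mulgI t)) /=.
  apply: eq_big => [s|s _]; last by rewrite multislice_permM.
  by rewrite groupMl // (subsetP (SymS sub)).
rewrite sumr_const -[_ *+ _]mulr_natr.
by rewrite mulfK ?gt_eqF ?card_Sym_gt0 // mulfK ?gt_eqF ?card_Sym_gt0.
Qed.

Lemma symavg_sub_symavg S S' g u : S' \subset S ->
  symavg S' (symavg S g) u = symavg S g u.
Proof.
move=> sub; apply: symavg_id => s sS'; rewrite symavg_perm //.
exact: (subsetP (SymS sub)).
Qed.

Lemma uexpect_perm g s : uexpect (fun u => g (u ## s)) = uexpect g.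
Proof.
rewrite /uexpect; congr (_ / _).
by rewrite [RHS](reindex_inj (can_inj (multislice_permK s))).
Qed.

(** Self-adjointness, by inverting the permutation and using the invariance of the uniform law. *)
Lemma uexpect_symavgM S g h :
  uexpect (fun u => symavg S g u * h u) = uexpect (fun u => g u * symavg S h u).
Proof.
rewrite /uexpect; congr (_ / _).
rewrite (eq_bigr (fun u => \sum_(s in Sym S) (g (u ## s) * h u / #|Sym S|%:R))); last first.
  by move=> u _; rewrite /symavg mulrAC !mulr_suml.
rewrite [RHS](eq_bigr (fun u => \sum_(s in Sym S) (g u * h (u ## s) / #|Sym S|%:R))); last first.
  by move=> u _; rewrite /symavg mulrA mulr_sumr mulr_suml.
rewrite exchange_big [RHS]exchange_big /= [RHS](reindex_inj invg_inj) /=.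
apply: eq_big => [s|s _]; first by rewrite groupV.
rewrite [RHS](reindex_inj (can_inj (multislice_permK s))) /=.
by apply: eq_bigr => u _; rewrite multislice_permK.
Qed.

Lemma uexpect_symavg S g : uexpect (symavg S g) = uexpect g.
Proof.
have := uexpect_symavgM S g (fun=> 1).
rewrite /uexpect (eq_bigr (symavg S g)) => [|u _]; last by rewrite mulr1.
by move=> ->; congr (_ / _); apply: eq_bigr => u _; rewrite symavg_cst mulr1.
Qed.

Definition color_count S u (i : 'I_l) : nat := #|[set x in S | val u x == i]|.

Lemma color_count_perm S u s i : s \in Sym S ->
  color_count S (u ## s) i = color_count S u i.
Proof.
move=> sS; rewrite /color_count -(card_preimset [set x in S | val u x == i] (@perm_inj _ s)).
by apply: eq_card => x; rewrite !inE ffunE Sym_closed.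
Qed.

Lemma color_count_setT u i : color_count [set: 'I_n] u i = kappa i.
Proof.
have /forallP/(_ i)/eqP <- := valP u.
by apply: eq_card => x; rewrite !inE.
Qed.

(** The orbits of [Sym S] are the fibers of the restriction to the complement of [S], so invariance
    under [Sym S] means dependence on the other coordinates only. The induction is on the number of
    disagreements, one swap repairing a position [j]. *)
Lemma multislice_transitive S u v :
  (forall x, x \notin S -> val u x = val v x) ->
  exists2 s, s \in Sym S & v = u ## s.
Proof.
move: {2}#|[set x | val u x != val v x]| (leqnn #|[set x | val u x != val v x]|) => m.
elim: m u => [|m IH] u.
  rewrite leqn0 cards_eq0 => /eqP D0 _; exists 1%g; first exact: group1.
  rewrite multislice_perm1; apply/esym/val_inj/ffunP => x.
  by apply/eqP/negPn; have := in_set0 x; rewrite -D0 inE => ->.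
move=> Dm agree.
have [j|noD] := pickP (fun x => val u x != val v x); last first.
  apply: IH agree; rewrite (_ : [set x | _] = set0) ?cards0 //.
  by apply/setP => x; rewrite !inE noD.
move=> /= jD.
(* Otherwise the positions that [u] colors [val v j] lie among those that [v] so colors; both sets
   have the same size, given by [kappa], so they coincide and [u] agrees with [v] at [j]. The swap
   creates no disagreement, since [u] and [v] already differ at [k]. *)
have [k] : exists2 k, k \in [set x | val u x == val v j] &
    k \notin [set x | val v x == val v j].
  apply/subsetPn; apply: contra jD => sub.
  have /forallP/(_ (val v j))/eqP cu := valP u.
  have /forallP/(_ (val v j))/eqP cv := valP v.
  have : j \in [set x | val v x == val v j] by rewrite inE.
  by rewrite -(subset_cardP _ sub) ?inE // cu cv.
rewrite !inE => /eqP uk vk.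
have jS : j \in S by apply: contraNT jD => /agree ->.
have kS : k \in S by apply: contraNT vk => /agree <-; rewrite uk.
have [||s sS ->] := IH (u ## tperm j k).
- have : [set x | val (u ## tperm j k) x != val v x] \subset
      [set x | val u x != val v x] :\ j.
    apply/subsetP => x; rewrite !inE ffunE.
    case: tpermP => [->|->|/eqP -> _ ->] //; first by rewrite uk eqxx.
    move=> _; rewrite uk [val v j == _]eq_sym vk andbT.
    by apply: contraNneq vk => ->.
  move=> /subset_leq_card /leq_trans; apply.
  have := cardsD1 j [set x | val u x != val v x].
  by rewrite inE jD add1n => cD; rewrite -ltnS -cD.
- move=> x xS; rewrite ffunE tpermD ?agree //; first by apply: contraNneq xS => <-.
  by apply: contraNneq xS => <-.
by exists (s * tperm j k)%g; rewrite ?multislice_permM // groupMr ?tperm_Sym.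
Qed.

End SymmetricAverage.

(** * The log-Sobolev inequality for transpositions *)

Section LogSobolev.

Variables (R : realType) (n l : nat) (kappa : 'I_l -> nat).

Local Notation X := (multislice n kappa).
Local Notation "u ## s" := (multislice_perm u s%g) (at level 25, left associativity).

Implicit Types (S : {set 'I_n}) (u v : X) (s t : 'S_n) (g h : X -> R).

Definition sqdiff g a b u : R := (g u - g (u ## tperm a b)) ^+ 2.

Lemma sqdiff_ge0 g a b u : 0 <= sqdiff g a b u.
Proof. exact: sqr_ge0. Qed.

Lemma sqdiffxx g a u : sqdiff g a a u = 0.
Proof. by rewrite /sqdiff tperm1 multislice_perm1 subrr expr0n. Qed.

(* The cap by 1 makes colors absent from [S] harmless. *)
Definition log_inv_freq S u : R :=
  \sum_(i < l) ln (#|S|%:R / (maxn 1 (color_count S u i))%:R).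

Lemma log_inv_freq_perm S u s : s \in Sym S ->
  log_inv_freq S (u ## s) = log_inv_freq S u.
Proof. by move=> sS; apply: eq_bigr => i _; rewrite color_count_perm. Qed.

Lemma color_count_le S u i : (color_count S u i <= #|S|)%N.
Proof. by apply/subset_leq_card/subsetP => x; rewrite !inE => /andP[]. Qed.

Lemma color_count_gt0 S u j : j \in S -> (0 < color_count S u (val u j))%N.
Proof. by move=> jS; apply/card_gt0P; exists j; rewrite !inE jS eqxx. Qed.

Lemma color_count_setD1 S u j i : j \in S ->
  color_count S u i = ((val u j == i) + color_count (S :\ j) u i)%N.
Proof.
move=> jS; rewrite /color_count (cardsD1 j) !inE jS /=; congr addn.
by apply: eq_card => x; rewrite !inE andbA.
Qed.

Lemma log_inv_freq_term_ge0 S u i : (0 < #|S|)%N ->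
  0 <= ln (#|S|%:R / (maxn 1 (color_count S u i))%:R) :> R.
Proof.
move=> S0; apply: ln_ge0; rewrite ler_pdivlMr ?ltr0n ?leq_max //.
by rewrite mul1r ler_nat geq_max S0 color_count_le.
Qed.

Lemma log_inv_freq_ge0 S u : (0 < #|S|)%N -> 0 <= log_inv_freq S u.
Proof. by move=> S0; apply: sumr_ge0 => i _; exact: log_inv_freq_term_ge0. Qed.

Lemma inv_freq_le S u j : j \in S ->
  #|S|%:R / (color_count S u (val u j))%:R <= expR (log_inv_freq S u).
Proof.
move=> jS; have S0 : (0 < #|S|)%N by apply/card_gt0P; exists j.
have c0 := color_count_gt0 u jS.
have p : (0 : R) < #|S|%:R / (color_count S u (val u j))%:R by rewrite divr_gt0 ?ltr0n.
rewrite -[leLHS]lnK ?posrE // ler_expR /log_inv_freq (bigD1 (val u j)) //=.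
rewrite (maxn_idPr c0) lerDl sumr_ge0 // => i _; exact: log_inv_freq_term_ge0.
Qed.

(** Dropping one of [k] occurrences of a color costs [ln (k / (k - 1)) <= 1 / (k - 1) <= 2 / k]; for
    [k = 1] the cap leaves the denominator unchanged. *)
Lemma ln_ratio_pred_le (a k : nat) : (0 < a)%N -> (0 < k)%N ->
  ln (a%:R / (maxn 1 k.-1)%:R) <= ln (a.+1%:R / k%:R) + 2 / k%:R :> R.
Proof.
case: k => // -[|k] a0 _ /=.
  rewrite !divr1 -[leLHS]addr0 lerD //.
  by rewrite ler_ln ?posrE ?ltr0n // ler_nat.
rewrite (maxn_idPr (isT : (1 <= k.+1)%N)).
have k0 : (0 : R) < k.+1%:R by rewrite ltr0n.
have k1 : (0 : R) < k.+2%:R by rewrite ltr0n.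
have a0' : (0 : R) < a%:R by rewrite ltr0n.
have a1 : (0 : R) < a.+1%:R by rewrite ltr0n.
rewrite !ln_div ?posrE //.
have lea : ln a%:R <= ln a.+1%:R :> R by rewrite ler_ln ?posrE // ler_nat.
have := ln_le_sub1 (divr_gt0 k1 k0); rewrite ln_div ?posrE //.
have -> : k.+2%:R / k.+1%:R - 1 = k.+1%:R^-1 :> R.
  by rewrite -natr1 mulrDl divff ?gt_eqF // mul1r addrAC subrr add0r.
have : k.+1%:R^-1 <= 2 / k.+2%:R :> R.
  by rewrite ler_pdivlMr // mulrC ler_pdivrMr // -natrM ler_nat mul2n -addnn addSn addnS !ltnS leq_addr.
move=> h1 h2; move: (le_trans h2 h1) lea; clear.
by move: (2 / _) (ln _) (ln _) (ln _) (ln _) => c x1 x2 x3 x4; lra.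
Qed.

(** Only the term of the color at [j] can grow; in the others the numerator [#|S|] drops and the
    count stays. *)
Lemma log_inv_freq_setD1 S u j : j \in S -> (1 < #|S|)%N ->
  log_inv_freq (S :\ j) u <=
  log_inv_freq S u + 2 / (color_count S u (val u j))%:R.
Proof.
move=> jS S1; have cS := cardsD1 j S; rewrite jS add1n in cS.
have cD0 : (0 < #|S :\ j|)%N by rewrite -ltnS -cS.
rewrite /log_inv_freq (bigD1 (val u j)) //= [X in _ <= X + _](bigD1 (val u j)) //=.
rewrite [leRHS]addrAC lerD //.
  have := ln_ratio_pred_le cD0 (color_count_gt0 u jS).
  rewrite (maxn_idPr (color_count_gt0 u jS)) -cS.
  by rewrite (color_count_setD1 _ _ jS) eqxx add1n /=.
apply: ler_sum => i ij; rewrite (color_count_setD1 _ _ jS) eq_sym (negPf ij) add0n.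
have m0 : (0 : R) < (maxn 1 (color_count (S :\ j) u i))%:R by rewrite ltr0n leq_max.
rewrite ler_ln ?posrE ?divr_gt0 ?ltr0n ?cS ?leq_max //.
by rewrite ler_pM2r ?invr_gt0 // ler_nat leqnSn.
Qed.

(** Each color present in [S] contributes exactly 1. Hence the increments of [log_inv_freq_setD1],
    summed over [j], stay below [2 * l]. *)
Lemma sum_inv_color_count S u :
  \sum_(j in S) (color_count S u (val u j))%:R^-1 <= l%:R :> R.
Proof.
rewrite (partition_big (fun j => val u j) predT) //=.
apply: (@le_trans _ _ (\sum_(i < l) 1)); last by rewrite sumr_const card_ord.
apply: ler_sum => i _.
rewrite (eq_bigr (fun=> (color_count S u i)%:R^-1)) => [|j /andP[_ /eqP->]] //.
rewrite sumr_const -[_ *+ _]mulr_natr.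
have -> : #|[pred j in S | val u j == i]| = color_count S u i.
  by apply: eq_card => x; rewrite !inE.
have [->|c0] := posnP (color_count S u i); first by rewrite mulr0.
by rewrite mulVf // pnatr_eq0 -lt0n.
Qed.

(** Match each [s] sending [j] to [k] with [s * tperm k k'], which sends [j] to [k'], and apply the
    triangle inequality. Moving the swap past [s] conjugates it into the transposition of [j] and
    [s^-1 k']. *)
Lemma sqr_sub_sqrt_symavg_le S j k k' g u : j \in S -> k \in S -> k' \in S ->
  (Num.sqrt (symavg (S :\ j) (fun v => g v ^+ 2) (u ## tperm j k))
   - Num.sqrt (symavg (S :\ j) (fun v => g v ^+ 2) (u ## tperm j k'))) ^+ 2 <=
  (\sum_(s in Sym S | s j == k) sqdiff g j (s^-1%g k') (u ## s))
     / #|Sym (S :\ j)|%:R.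
Proof.
move=> jS kS k'S; have M0 := card_Sym_gt0 R (S :\ j).
rewrite !symavg_fiber // !sqrtrM ?sumr_ge0 //; try by move=> *; exact: sqr_ge0.
rewrite -mulrBl exprMn sqr_sqrtr ?invr_ge0 ?ler0n // ler_pM2r ?invr_gt0 //.
have -> : \sum_(s in Sym S | s j == k') g (u ## s) ^+ 2 =
    \sum_(s in Sym S | s j == k) g (u ## (s * tperm k k')) ^+ 2.
  rewrite (reindex_inj (mulIg (tperm k k'))) /=; apply: eq_bigl => s.
  rewrite groupMr ?tperm_Sym // permM.
  by rewrite -{2}(tpermL k k') (inj_eq perm_inj).
apply: le_trans (sqr_sub_sqrt_sum_le _ _ _) _.
apply: ler_sum => s /andP[_ /eqP sj]; rewrite conjgCV multislice_permM tpermJ.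
by rewrite -{1}sj permK.
Qed.

(** Summing over [k] lifts the constraint [s j = k], and [s^-1 k'] runs over [S] as [k'] does. *)
Lemma sum_sqr_sub_sqrt_symavg_le S j g u : j \in S ->
  \sum_(k in S) \sum_(k' in S)
    (Num.sqrt (symavg (S :\ j) (fun v => g v ^+ 2) (u ## tperm j k))
     - Num.sqrt (symavg (S :\ j) (fun v => g v ^+ 2) (u ## tperm j k'))) ^+ 2 <=
  #|S|%:R * \sum_(b in S) symavg S (sqdiff g j b) u.
Proof.
move=> jS.
apply: (@le_trans _ _ (\sum_(k in S) \sum_(k' in S)
  (\sum_(s in Sym S | s j == k) sqdiff g j (s^-1%g k') (u ## s))
     / #|Sym (S :\ j)|%:R)).
  by apply: ler_sum => k kS; apply: ler_sum => k' k'S; exact: sqr_sub_sqrt_symavg_le.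
have -> : #|S|%:R * \sum_(b in S) symavg S (sqdiff g j b) u =
   (\sum_(b in S) \sum_(s in Sym S) sqdiff g j b (u ## s)) / #|Sym (S :\ j)|%:R.
  rewrite /symavg -mulr_suml (card_Sym_setD1 R jS) mulrCA; congr (_ * _).
  rewrite invfM mulVKf // pnatr_eq0 -lt0n; apply/card_gt0P; by exists j.
rewrite exchange_big /=.
rewrite (eq_bigr (fun k' => (\sum_(s in Sym S) sqdiff g j (s^-1%g k') (u ## s)) /
    #|Sym (S :\ j)|%:R)); last first.
  move=> k' _; rewrite -mulr_suml; congr (_ / _).
  by rewrite [RHS](partition_big (fun s : 'S_n => s j) (mem S)) //= => s sS; rewrite Sym_closed.
rewrite -mulr_suml ler_pM2r ?invr_gt0 ?card_Sym_gt0 // exchange_big [leRHS]exchange_big /=.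
apply: ler_sum => s sS; rewrite (reindex_inj (@perm_inj _ s)) /=.
rewrite (eq_bigl (mem S)) => [|b]; last by rewrite /= Sym_closed.
by apply: ler_sum => b _; rewrite permK.
Qed.

Definition condent S g u : R :=
  symavg S (fun v => g v * ln (g v)) u - symavg S g u * ln (symavg S g u).

(** The chain rule of entropy: the mean of [x * ln x] over the conditional expectations is added and
    subtracted. *)
Lemma condent_setD1 S j g u : j \in S ->
  condent S g u =
  (\sum_(k in S) condent (S :\ j) g (u ## tperm j k)) / #|S|%:R +
  ((\sum_(k in S) symavg (S :\ j) g (u ## tperm j k)
       * ln (symavg (S :\ j) g (u ## tperm j k))) / #|S|%:R
   - (\sum_(k in S) symavg (S :\ j) g (u ## tperm j k)) / #|S|%:R
     * ln ((\sum_(k in S) symavg (S :\ j) g (u ## tperm j k)) / #|S|%:R)).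
Proof.
move=> jS; rewrite {1}/condent !(symavg_setD1 _ _ jS) sumrB mulrBl.
by rewrite addrA subrK.
Qed.

(** The finite-space inequality is applied to the square roots [psi k] of the conditional second
    moments. *)
Lemma color_entropy_le S j g u : j \in S ->
  (\sum_(k in S) symavg (S :\ j) (fun v => g v ^+ 2) (u ## tperm j k)
       * ln (symavg (S :\ j) (fun v => g v ^+ 2) (u ## tperm j k))) / #|S|%:R
   - (\sum_(k in S) symavg (S :\ j) (fun v => g v ^+ 2) (u ## tperm j k)) / #|S|%:R
     * ln ((\sum_(k in S) symavg (S :\ j) (fun v => g v ^+ 2) (u ## tperm j k)) / #|S|%:R)
  <= (5 + 8 * log_inv_freq S u) / (2 * #|S|%:R) *
     \sum_(b in S) symavg S (sqdiff g j b) u.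
Proof.
move=> jS; have S0 : (0 < #|S|)%N by apply/card_gt0P; exists j.
have N0 : (0 : R) < #|S|%:R by rewrite ltr0n.
pose psi k := Num.sqrt (symavg (S :\ j) (fun v => g v ^+ 2) (u ## tperm j k)).
have psi0 k : 0 <= psi k by exact: sqrtr_ge0.
have psiE k : symavg (S :\ j) (fun v => g v ^+ 2) (u ## tperm j k) = psi k ^+ 2.
  by rewrite sqr_sqrtr // symavg_ge0 // => v; exact: sqr_ge0.
under eq_bigr => k _ do rewrite psiE.
under [X in _ - X / _ * _]eq_bigr => k _ do rewrite psiE.
under [X in ln (X / _)]eq_bigr => k _ do rewrite psiE.
(* If [k] and [k'] have one color, the two swapped configurations agree at [j] and outside [S],
   hence lie in one orbit of [Sym (S :\ j)]. *)
have psi_color k k' : k \in S -> k' \in S -> val u k = val u k' -> psi k = psi k'.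
  move=> kS k'S ukk'; rewrite /psi; congr Num.sqrt.
  have [|s sS ->] := @multislice_transitive n l kappa (S :\ j)
      (u ## tperm j k) (u ## tperm j k'); last by rewrite (symavg_perm _ _ sS).
  move=> x; rewrite !inE negb_and negbK => /orP[/eqP->|xS].
    by rewrite !ffunE !tpermL.
  have nx y : y \in S -> y != x by move=> yS; apply: contraNneq xS => <-.
  by rewrite !ffunE !tpermD ?nx.
set th := log_inv_freq S u.
have th0 : 0 <= th by exact: log_inv_freq_ge0.
have T1 : 1 <= expR th by rewrite -expR0 ler_expR.
(* A color of frequency [q] in [S] contributes [q * psi k] to the mean, so [psi k] is at most
   [1 / q] times the mean, and [1 / q <= expR th]. *)
have bound k : k \in S -> psi k <= expR th * ((\sum_(i in S) psi i) / #|S|%:R).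
  move=> kS; set c := color_count S u (val u k).
  have c0 : (0 : R) < c%:R by rewrite ltr0n color_count_gt0.
  have le1 : c%:R * psi k <= \sum_(i in S) psi i.
    rewrite (bigID (fun i => val u i == val u k)) /=.
    rewrite [X in _ <= X + _](eq_bigr (fun=> psi k)); last first.
      by move=> i /andP[iS /eqP ui]; exact: psi_color.
    rewrite sumr_const -[psi k *+ _]mulr_natl.
    have -> : #|[pred i in S | val u i == val u k]| = c.
      by apply: eq_card => x; rewrite !inE.
    by rewrite lerDl sumr_ge0.
  have := inv_freq_le u kS; rewrite -/c -/th => le2.
  have m0 : 0 <= (\sum_(i in S) psi i) / #|S|%:R by rewrite divr_ge0 ?ler0n // sumr_ge0.
  apply: le_trans (ler_wpM2r m0 le2).
  rewrite mulrA -[#|S|%:R / _ * _]mulrA [_ * (c%:R^-1 * _)]mulrC -mulrA mulfV ?gt_eqF //.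
  by rewrite mulr1 mulrC ler_pdivlMr // mulrC.
apply: le_trans (sqr_entropy_mean_le S0 T1 (fun i _ => psi0 i) bound) _.
rewrite expRK.
have := sum_sqr_sub_sqrt_symavg_le g u jS; rewrite -/psi => h.
apply: (@le_trans _ _ ((5 + 8 * th) / (2 * #|S|%:R ^+ 2) *
   (#|S|%:R * \sum_(b in S) symavg S (sqdiff g j b) u))).
  rewrite ler_wpM2l // divr_ge0 ?mulr_ge0 ?exprn_ge0 ?ler0n //.
  by rewrite addr_ge0 ?mulr_ge0.
rewrite le_eqVlt; apply/orP; left; apply/eqP.
by field; rewrite gt_eqF.
Qed.

(** After exchanging the sums, the pair [a], [b] collects the weights [c j] of all [j] in [S] other
    than [a] and [b]. *)
Lemma sum_weight_sqdiff_le S g v (c : 'I_n -> R) (w : R) :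
  (forall a b, a \in S -> b \in S -> a != b ->
     \sum_(j in S :\ a :\ b) c j <= w) ->
  \sum_(j in S) (c j * \sum_(a in S :\ j) \sum_(b in S :\ j) sqdiff g a b v)
   <= w * \sum_(a in S) \sum_(b in S) sqdiff g a b v.
Proof.
move=> cw.
have -> : \sum_(j in S) (c j * \sum_(a in S :\ j) \sum_(b in S :\ j) sqdiff g a b v)
  = \sum_(a in S) \sum_(b in S) (\sum_(j in S :\ a :\ b) c j) * sqdiff g a b v.
  transitivity (\sum_(j in S) \sum_(a in S) \sum_(b in S)
      (if (j != a) && (j != b) then c j * sqdiff g a b v else 0)).
    apply: eq_bigr => j jS; rewrite mulr_sumr.
    rewrite (eq_bigl (fun a => (a \in S) && (a != j))); last by move=> a; rewrite !inE andbC.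
    rewrite big_mkcondr; apply: eq_bigr => a aS; rewrite [j == a]eq_sym.
    case: (a != j) => /=; last by rewrite big1.
    rewrite mulr_sumr.
    rewrite (eq_bigl (fun b => (b \in S) && (b != j))); last by move=> b; rewrite !inE andbC.
    by rewrite big_mkcondr; apply: eq_bigr => b _; rewrite eq_sym.
  rewrite exchange_big; apply: eq_bigr => a aS; rewrite exchange_big.
  apply: eq_bigr => b bS; rewrite mulr_suml -big_mkcondr.
  by apply: eq_bigl => j; rewrite !inE; case: (j \in S) (j == a) (j == b) => [] [] [].
rewrite mulr_sumr; apply: ler_sum => a aS; rewrite mulr_sumr.
apply: ler_sum => b bS; have [->|ab] := eqVneq a b; first by rewrite sqdiffxx !mulr0.
by rewrite ler_wpM2r ?sqdiff_ge0 // cw.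
Qed.

Lemma sum_inv_color_count_le S v a b : a \in S -> b \in S -> a != b ->
  \sum_(j in S :\ a :\ b) (3 * l%:R + log_inv_freq S v
      + 2 / (color_count S v (val v j))%:R)
  <= (#|S|%:R - 2) * (3 * l%:R + log_inv_freq S v) + 2 * l%:R.
Proof.
move=> aS bS ab; rewrite big_split /= sumr_const -[(_ + log_inv_freq S v) *+ _]mulr_natl lerD //.
  have -> : #|S| = (#|S :\ a :\ b|).+2.
    by rewrite (cardsD1 a S) aS (cardsD1 b (S :\ a)) !inE eq_sym ab bS.
  by rewrite -[(#|S :\ a :\ b|).+2]addn2 natrD addrK.
rewrite -mulr_sumr ler_wpM2l //.
apply: le_trans (sum_inv_color_count S v).
rewrite [leRHS](big_setD1 a) //= [X in _ <= _ + X](big_setD1 b) ?inE ?(eq_sym b) ?ab //=.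
rewrite addrA lerDr addr_ge0 ?invr_ge0 ?ler0n //.
Qed.

Lemma condent_set1 j g u : condent [set j] g u = 0.
Proof.
have id h : symavg [set j] h u = h u.
  apply: symavg_id => s sj; suff -> : s = 1%g by rewrite multislice_perm1.
  apply/permP => x; rewrite perm1; have [->|xj] := eqVneq x j.
    by apply/eqP; have := Sym_closed j sj; rewrite !inE eqxx.
  by move/mem_Sym: sj; apply; rewrite inE.
by rewrite /condent !id subrr.
Qed.

(* Induction on [#|S|]: the entropy splits over the color revealed at position
   [j], and the resulting bound is averaged over [j] in [S]. *)
Lemma log_sobolev S g u : (0 < l)%N -> (0 < #|S|)%N ->
  condent S (fun v => g v ^+ 2) u <=
  4 * (3 * l%:R + log_inv_freq S u) / #|S|%:R *
    \sum_(a in S) \sum_(b in S) symavg S (sqdiff g a b) u.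
Proof.
move=> l0; case cS: #|S| => [//|m] _.
elim: m S cS u => [|m IH] S cS u.
  have /cards1P[j Sj] : #|S| == 1%N by rewrite cS.
  have S0 : (0 < #|S|)%N by rewrite cS.
  rewrite Sj condent_set1 -Sj mulr_ge0 //.
    by rewrite divr_ge0 ?mulr_ge0 ?addr_ge0 ?mulr_ge0 ?ler0n ?log_inv_freq_ge0.
  apply: sumr_ge0 => a _; apply: sumr_ge0 => b _; apply: symavg_ge0 => v.
  exact: sqdiff_ge0.
have S0 : (0 < #|S|)%N by rewrite cS.
have S1 : (1 < #|S|)%N by rewrite cS.
rewrite -cS; set N : R := #|S|%:R; set th := log_inv_freq S u.
have th0 : 0 <= th by exact: log_inv_freq_ge0.
have N2 : 2 <= N by rewrite /N cS ler_nat.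
have NE : N - 1 = m.+1%:R by rewrite /N cS -[m.+2]addn1 natrD addrK.
have l1 : (1 : R) <= l%:R by rewrite ler1n.
set E := \sum_(a in S) _.
have E0 : 0 <= E.
  apply: sumr_ge0 => a _; apply: sumr_ge0 => b _; apply: symavg_ge0 => v.
  exact: sqdiff_ge0.
(* The constant of the induction hypothesis for [S :\ j], with the growth allowed by
   [log_inv_freq_setD1] included. *)
pose c j v : R := 4 / (N - 1) * (3 * l%:R + log_inv_freq S v
      + 2 / (color_count S v (val v j))%:R).
pose H j v : R := c j v * \sum_(a in S :\ j) \sum_(b in S :\ j) sqdiff g a b v.
have c_perm j v s : s \in Sym (S :\ j) -> c j (v ## s) = c j v.
  move=> sj; have sS : s \in Sym S by exact: (subsetP (SymS (subsetDl S [set j]))).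
  rewrite /c log_inv_freq_perm // ffunE.
  have -> : s j = j by move/mem_Sym: sj; apply; rewrite !inE eqxx.
  by rewrite color_count_perm.
have step j : j \in S -> condent S (fun v => g v ^+ 2) u <=
    symavg S (H j) u + (5 + 8 * th) / (2 * N) * \sum_(b in S) symavg S (sqdiff g j b) u.
  move=> jS; rewrite (condent_setD1 _ _ jS) lerD ?color_entropy_le //.
  rewrite (symavg_setD1 _ _ jS) ler_wpM2r ?invr_ge0 ?ler0n //.
  apply: ler_sum => k kS; set v := u ## tperm j k.
  have cSj : #|S :\ j| = m.+1 by move: cS; rewrite (cardsD1 j S) jS add1n => -[].
  apply: le_trans (IH _ cSj v) _.
  rewrite /H symavgM; last by move=> s; exact: c_perm.
  rewrite symavg_sum.
  under [X in _ <= _ * X]eq_bigr => a _ do rewrite symavg_sum.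
  apply: ler_wpM2r.
    apply: sumr_ge0 => a _; apply: sumr_ge0 => b _; apply: symavg_ge0 => w.
    exact: sqdiff_ge0.
  rewrite /c -cSj mulrAC NE cSj ler_wpM2l ?divr_ge0 ?ler0n //.
  by rewrite -addrA lerD2l log_inv_freq_setD1.
have tot : N * condent S (fun v => g v ^+ 2) u <=
    4 / (N - 1) * ((N - 2) * (3 * l%:R + th) + 2 * l%:R) * E
    + (5 + 8 * th) / (2 * N) * E.
  have -> : N * condent S (fun v => g v ^+ 2) u = \sum_(j in S) condent S (fun v => g v ^+ 2) u.
    by rewrite sumr_const -[condent _ _ _ *+ _]mulr_natl.
  apply: le_trans (ler_sum _ step) _; rewrite big_split /= -mulr_sumr lerD //.
  rewrite -symavg_sum.
  rewrite /E -(eq_bigr _ (fun a _ => symavg_sum S (mem S) (fun b => sqdiff g a b) u)).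
  rewrite -symavg_sum.
  have -> : 4 / (N - 1) * ((N - 2) * (3 * l%:R + th) + 2 * l%:R) *
      symavg S (fun v => \sum_(a in S) \sum_(b in S) sqdiff g a b v) u =
    symavg S (fun v => 4 / (N - 1) * ((N - 2) * (3 * l%:R + log_inv_freq S v) + 2 * l%:R) *
      \sum_(a in S) \sum_(b in S) sqdiff g a b v) u.
    by rewrite symavgM // => s sS; rewrite log_inv_freq_perm.
  apply: ler_symavg => s _; set v := u ## s; apply: sum_weight_sqdiff_le => a b aS bS ab.
  rewrite /c -mulr_sumr ler_wpM2l ?NE ?divr_ge0 ?ler0n //.
  exact: sum_inv_color_count_le.
have N1 : 0 < N - 1 by lra.
have Np : 0 < N by lra.
rewrite -(ler_pM2l Np); apply: le_trans tot _.
rewrite -mulrDl [leRHS]mulrA; apply: ler_wpM2r => //.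
have -> : N * (4 * (3 * l%:R + th) / N) = 4 * (3 * l%:R + th) by field; rewrite gt_eqF.
(* A pair survives in only [N - 2] of the sets [S :\ j], which saves
   [4 / (N - 1) * (3 * l%:R + th)], while the growth of the frequencies costs [8 * l%:R / (N - 1)].
   The difference pays for the color entropy, because [8 * l%:R >= 5]. *)
have -> : 4 / (N - 1) * ((N - 2) * (3 * l%:R + th) + 2 * l%:R) =
    4 * (3 * l%:R + th) - 4 / (N - 1) * (l%:R + th) by field; rewrite gt_eqF.
suff : (5 + 8 * th) / (2 * N) <= 4 / (N - 1) * (l%:R + th) by lra.
rewrite ler_pdivrMr ?mulr_gt0 //.
have -> : 4 / (N - 1) * (l%:R + th) * (2 * N) = 8 * (l%:R + th) * (N / (N - 1)).
  by field; rewrite gt_eqF.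
have r1 : 1 <= N / (N - 1) by rewrite ler_pdivlMr // mul1r; lra.
apply: (@le_trans _ _ (8 * (l%:R + th) * 1)); first lra.
by rewrite ler_wpM2l //; lra.
Qed.

End LogSobolev.

(** * Dirichlet form, martingale differences and influences of positions *)

Section MartingaleDecomposition.

Variables (R : realType) (n l : nat) (kappa : 'I_l -> nat).

Local Notation X := (multislice n kappa).
Local Notation "u ## s" := (multislice_perm u s%g) (at level 25, left associativity).

Implicit Types (S : {set 'I_n}) (u v : X) (s t : 'S_n) (f g h : X -> R).

Lemma eq_uexpect g h : g =1 h -> uexpect g = uexpect h.
Proof. by move=> gh; rewrite /uexpect (eq_bigr h). Qed.

Lemma ler_uexpect g h : (forall u, g u <= h u) -> uexpect g <= uexpect h.
Proof. by move=> gh; rewrite ler_wpM2r ?invr_ge0 ?ler0n // ler_sum. Qed.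

Lemma uexpect_ge0 g : (forall u, 0 <= g u) -> 0 <= uexpect g.
Proof. by move=> g0; rewrite divr_ge0 ?ler0n // sumr_ge0. Qed.

Lemma uexpectD g h : uexpect (fun u => g u + h u) = uexpect g + uexpect h.
Proof. by rewrite /uexpect big_split mulrDl. Qed.

Lemma uexpectZ (c : R) g : uexpect (fun u => c * g u) = c * uexpect g.
Proof. by rewrite /uexpect -mulr_sumr mulrA. Qed.

Lemma uexpectB g h : uexpect (fun u => g u - h u) = uexpect g - uexpect h.
Proof. by rewrite /uexpect sumrB mulrBl. Qed.

Lemma uexpect_sum (I : finType) (A : {pred I}) (G : I -> X -> R) :
  uexpect (fun u => \sum_(i in A) G i u) = \sum_(i in A) uexpect (G i).
Proof. by rewrite /uexpect exchange_big mulr_suml. Qed.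

Lemma symavg_setT g u : symavg [set: 'I_n] g u = uexpect g.
Proof.
have X0 : (0 : R) < #|{: X}|%:R by rewrite ltr0n; apply/card_gt0P; exists u.
rewrite -(uexpect_symavg [set: 'I_n]) /uexpect.
rewrite (eq_bigr (fun=> symavg [set: 'I_n] g u)); last first.
  move=> v _; have [x|s sT ->] := @multislice_transitive n l kappa [set: 'I_n] u v.
    by rewrite inE.
  by rewrite (symavg_perm _ _ sT).
by rewrite sumr_const -[symavg _ _ _ *+ _]mulr_natr mulfK ?gt_eqF.
Qed.

(** Summing over ordered pairs counts each transposition twice; the diagonal contributes 0. *)
Definition dirichlet g : R := \sum_a \sum_b uexpect (sqdiff g a b).

Definition laplacian g u : R := \sum_a \sum_b (g u - g (u ## tperm a b)).

Lemma dirichlet_ge0 g : 0 <= dirichlet g.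
Proof.
by apply: sumr_ge0 => a _; apply: sumr_ge0 => b _; apply: uexpect_ge0 => u; exact: sqdiff_ge0.
Qed.

Lemma uexpect_log_sobolev g u : (0 < l)%N -> (0 < n)%N ->
  uexpect (fun v => g v ^+ 2 * ln (g v ^+ 2))
    - uexpect (fun v => g v ^+ 2) * ln (uexpect (fun v => g v ^+ 2)) <=
  4 * (3 * l%:R + log_inv_freq R [set: 'I_n] u) / n%:R * dirichlet g.
Proof.
move=> l0 n0; have cT : #|[set: 'I_n]| = n by rewrite cardsT card_ord.
have := log_sobolev (S := [set: 'I_n]) g u l0; rewrite cT => /(_ n0).
rewrite /condent !symavg_setT => /le_trans; apply.
rewrite le_eqVlt; apply/orP; left; apply/eqP; congr (_ * _).
rewrite (eq_bigl predT) => [|a]; last by rewrite inE.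
apply: eq_bigr => a _; rewrite (eq_bigl predT) => [|b]; last by rewrite inE.
by apply: eq_bigr => b _; rewrite symavg_setT.
Qed.

Lemma dirichletE g : dirichlet g = 2 * uexpect (fun u => laplacian g u * g u).
Proof.
rewrite /dirichlet.
have -> : uexpect (fun u => laplacian g u * g u) =
    \sum_a \sum_b uexpect (fun u => (g u - g (u ## tperm a b)) * g u).
  under eq_uexpect => u.
    rewrite /laplacian mulr_suml.
    under eq_bigr => a _ do rewrite mulr_suml.
    over.
  rewrite uexpect_sum; apply: eq_bigr => a _.
  by rewrite uexpect_sum.
rewrite mulr_sumr; apply: eq_bigr => a _; rewrite mulr_sumr; apply: eq_bigr => b _.
have tt u : u ## tperm a b ## tperm a b = u by rewrite -multislice_permM tperm2 multislice_perm1.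
have sym : uexpect (fun u => g (u ## tperm a b) ^+ 2) = uexpect (fun u => g u ^+ 2).
  exact: (uexpect_perm (fun u => g u ^+ 2)).
rewrite (@eq_uexpect _ (fun u => g u ^+ 2 + (g (u ## tperm a b) ^+ 2
    + (- 2) * (g u * g (u ## tperm a b))))); last by move=> u; rewrite /sqdiff; ring.
rewrite (@eq_uexpect (fun u => (g u - g (u ## tperm a b)) * g u)
   (fun u => g u ^+ 2 - g u * g (u ## tperm a b))); last by move=> u; ring.
by rewrite uexpectB !uexpectD uexpectZ sym; ring.
Qed.

(** Conjugation by [s] permutes the transpositions, so their sum is central. *)
Lemma laplacian_symavg S g u : laplacian (symavg S g) u = symavg S (laplacian g) u.
Proof.
rewrite /laplacian {2}/symavg.
transitivity (\sum_a \sum_b (\sum_(s in Sym S) (g (u ## s) - g (u ## tperm a b ## s))) / #|Sym S|%:R).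
  by apply: eq_bigr => a _; apply: eq_bigr => b _; rewrite sumrB mulrBl.
under eq_bigr => a _ do rewrite -mulr_suml exchange_big.
rewrite -mulr_suml exchange_big /=; congr (_ / _); apply: eq_bigr => s _.
rewrite (reindex_inj (@perm_inj _ s)) /=; apply: eq_bigr => a _.
rewrite (reindex_inj (@perm_inj _ s)) /=; apply: eq_bigr => b _.
by rewrite -multislice_permM conjgCV multislice_permM tpermJ !permK.
Qed.

Lemma uexpect_laplacian_symavg S S' f :
  uexpect (fun u => laplacian (symavg S f) u * symavg S' f u) =
  uexpect (fun u => laplacian f u * symavg S (symavg S' f) u).
Proof.
rewrite -(uexpect_symavgM S (laplacian f)).
by apply: eq_uexpect => u; rewrite laplacian_symavg.
Qed.

Lemma laplacianB g h u :
  laplacian (fun v => g v - h v) u = laplacian g u - laplacian h u.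
Proof.
rewrite /laplacian -sumrB; apply: eq_bigr => a _; rewrite -sumrB.
by apply: eq_bigr => b _; ring.
Qed.

Lemma dirichlet_symavg S f :
  dirichlet (symavg S f) = 2 * uexpect (fun u => laplacian f u * symavg S f u).
Proof.
rewrite dirichletE uexpect_laplacian_symavg; congr (_ * _).
by apply: eq_uexpect => u; rewrite symavg_symavg_sub.
Qed.

(** The averages over nested sets are self-adjoint projections commuting with the Laplacian, so
    every cross term equals the form of the coarser average [symavg S f]. *)
Lemma dirichlet_symavgB S S' f : S' \subset S ->
  dirichlet (fun u => symavg S' f u - symavg S f u) =
  dirichlet (symavg S' f) - dirichlet (symavg S f).
Proof.
move=> sub; rewrite dirichletE !dirichlet_symavg -mulrBr; congr (_ * _).
rewrite (@eq_uexpect _ (fun u => laplacian (symavg S' f) u * symavg S' f u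
  - laplacian (symavg S' f) u * symavg S f u
  - (laplacian (symavg S f) u * symavg S' f u
     - laplacian (symavg S f) u * symavg S f u))); last first.
  by move=> u; rewrite laplacianB; ring.
rewrite !uexpectB !uexpect_laplacian_symavg.
have e1 : uexpect (fun u => laplacian f u * symavg S' (symavg S' f) u) =
  uexpect (fun u => laplacian f u * symavg S' f u).
  by apply: eq_uexpect => u; rewrite symavg_symavg_sub.
have e2 : uexpect (fun u => laplacian f u * symavg S' (symavg S f) u) =
  uexpect (fun u => laplacian f u * symavg S f u).
  by apply: eq_uexpect => u; rewrite symavg_sub_symavg.
have e3 : uexpect (fun u => laplacian f u * symavg S (symavg S' f) u) =
  uexpect (fun u => laplacian f u * symavg S f u).
  by apply: eq_uexpect => u; rewrite symavg_symavg_sub.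
have e4 : uexpect (fun u => laplacian f u * symavg S (symavg S f) u) =
  uexpect (fun u => laplacian f u * symavg S f u).
  by apply: eq_uexpect => u; rewrite symavg_symavg_sub.
by rewrite e1 e2 e3 e4; ring.
Qed.

(** Pythagoras for the same projections, with the identity in place of the Laplacian. *)
Lemma uexpect_sqr_symavgB S S' f : S' \subset S ->
  uexpect (fun u => (symavg S' f u - symavg S f u) ^+ 2) =
  uexpect (fun u => f u * symavg S' f u) - uexpect (fun u => f u * symavg S f u).
Proof.
move=> sub.
rewrite (@eq_uexpect _ (fun u => symavg S' f u * symavg S' f u
  - symavg S' f u * symavg S f u
  - (symavg S f u * symavg S' f u
     - symavg S f u * symavg S f u))); last by move=> u; ring.
rewrite !uexpectB !uexpect_symavgM.
have e1 : uexpect (fun u => f u * symavg S' (symavg S' f) u) =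
  uexpect (fun u => f u * symavg S' f u).
  by apply: eq_uexpect => u; rewrite symavg_symavg_sub.
have e2 : uexpect (fun u => f u * symavg S' (symavg S f) u) =
  uexpect (fun u => f u * symavg S f u).
  by apply: eq_uexpect => u; rewrite symavg_sub_symavg.
have e3 : uexpect (fun u => f u * symavg S (symavg S' f) u) =
  uexpect (fun u => f u * symavg S f u).
  by apply: eq_uexpect => u; rewrite symavg_symavg_sub.
have e4 : uexpect (fun u => f u * symavg S (symavg S f) u) =
  uexpect (fun u => f u * symavg S f u).
  by apply: eq_uexpect => u; rewrite symavg_symavg_sub.
by rewrite e1 e2 e3 e4; ring.
Qed.

Definition l1_influence f s : R := uexpect (fun u => `|f u - f (u ## s)|).

(** Division by [n] makes these add up to [O(K)] for a Boolean function of total influence at most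
    [K * n]. *)
Definition coord_influence f j : R := (\sum_k l1_influence f (tperm j k)) / n%:R.

Lemma l1_influence_ge0 f s : 0 <= l1_influence f s.
Proof. exact: uexpect_ge0. Qed.

Lemma l1_influence1 f : l1_influence f 1 = 0.
Proof.
rewrite /l1_influence (@eq_uexpect _ (fun=> 0)) => [|u].
  by rewrite /uexpect big1 ?mul0r.
by rewrite multislice_perm1 subrr normr0.
Qed.

Lemma l1_influenceM f s t :
  l1_influence f (s * t) <= l1_influence f s + l1_influence f t.
Proof.
rewrite /l1_influence -(uexpect_perm (fun u => `|f u - f (u ## s)|) t) -uexpectD.
apply: ler_uexpect => u; rewrite multislice_permM.
have -> : f u - f (u ## t ## s) = (f (u ## t) - f (u ## t ## s)) + (f u - f (u ## t)) by ring.
exact: ler_normD.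
Qed.

Lemma coord_influence_ge0 f j : 0 <= coord_influence f j.
Proof. by rewrite divr_ge0 ?ler0n // sumr_ge0 // => k _; exact: l1_influence_ge0. Qed.

(* Average over [i] the decomposition [(j k) = (j i) (i k) (j i)]. *)
Lemma l1_influence_tperm_le f j k :
  l1_influence f (tperm j k) <= 2 * coord_influence f j + coord_influence f k.
Proof.
have n0 : (0 < n)%N by case: (n) j => // -[].
have N0 : (0 : R) < n%:R by rewrite ltr0n.
rewrite /coord_influence mulrA -mulrDl ler_pdivlMr //.
have -> : l1_influence f (tperm j k) * n%:R = \sum_(i < n) l1_influence f (tperm j k).
  by rewrite sumr_const card_ord -[l1_influence _ _ *+ _]mulr_natr.
rewrite mulr_sumr -big_split /=; apply: ler_sum => i _.
have ge0 := l1_influence_ge0 f.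
have [->|jk] := eqVneq j k.
  by rewrite tperm1 l1_influence1; have := ge0 (tperm k i); lra.
have [->|ij] := eqVneq i j.
  by rewrite tperm1 l1_influence1 mulr0 add0r tpermC.
have [->|ik] := eqVneq i k.
  by rewrite tperm1 l1_influence1 addr0; have := ge0 (tperm j k); lra.
have -> : tperm j k = (tperm j i * (tperm i k * tperm j i))%g.
  by rewrite -{1}[tperm j i]tpermV -conjgE tpermJ tpermR tpermD // eq_sym.
have := l1_influenceM f (tperm j i) (tperm i k * tperm j i).
have := l1_influenceM f (tperm i k) (tperm j i).
rewrite [tperm k i]tpermC; lra.
Qed.

(** Revealing [j] compares [f] at two points that differ by the transposition of [j] and some
    [s^-1 k] in [S]. By [l1_influence_tperm_le] this costs twice the influence of [j] plus that of
    [s^-1 k], and the latter is no larger. *)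
Lemma uexpect_norm_martingale_le S j f : j \in S ->
  (forall k, k \in S -> coord_influence f k <= coord_influence f j) ->
  uexpect (fun u => `|symavg (S :\ j) f u - symavg S f u|) <= 3 * coord_influence f j.
Proof.
move=> jS jmax; have S0 : (0 < #|S|)%N by apply/card_gt0P; exists j.
have N0 : (0 : R) < #|S|%:R by rewrite ltr0n.
have M0 := card_Sym_gt0 R (S :\ j).
apply: (@le_trans _ _ (uexpect (fun u => \sum_(k in S) \sum_(s in Sym (S :\ j))
    (#|S|%:R^-1 * #|Sym (S :\ j)|%:R^-1) * `|f (u ## s) - f (u ## tperm j k ## s)|))).
  apply: ler_uexpect => u.
  have -> : symavg (S :\ j) f u - symavg S f u = \sum_(k in S) \sum_(s in Sym (S :\ j))
     (#|S|%:R^-1 * #|Sym (S :\ j)|%:R^-1) * (f (u ## s) - f (u ## tperm j k ## s)).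
    rewrite (symavg_setD1 _ _ jS).
    have -> : symavg (S :\ j) f u = (\sum_(k in S) symavg (S :\ j) f u) / #|S|%:R.
      by rewrite sumr_const -[symavg _ _ _ *+ _]mulr_natr mulfK ?gt_eqF.
    rewrite -mulrBl -sumrB mulr_suml; apply: eq_bigr => k _.
    by rewrite /symavg -mulrBl -sumrB -mulr_sumr mulrC mulrA mulrAC.
  apply: le_trans (ler_norm_sum _ _ _) _; apply: ler_sum => k _.
  apply: le_trans (ler_norm_sum _ _ _) _; apply: ler_sum => s _.
  by rewrite normrM ger0_norm // mulr_ge0 ?invr_ge0 ?ler0n.
rewrite uexpect_sum.
apply: (@le_trans _ _ (\sum_(k in S) \sum_(s in Sym (S :\ j))
   (#|S|%:R^-1 * #|Sym (S :\ j)|%:R^-1) * (3 * coord_influence f j))).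
  apply: ler_sum => k kS; rewrite uexpect_sum; apply: ler_sum => s sS.
  rewrite uexpectZ ler_wpM2l ?mulr_ge0 ?invr_ge0 ?ler0n //.
  have sj : s^-1%g j = j.
    by apply/eqP; rewrite -(inj_eq (@perm_inj _ s)) permKV eq_sym; apply/eqP;
      move/mem_Sym: sS; apply; rewrite !inE eqxx.
  have -> : uexpect (fun u => `|f (u ## s) - f (u ## tperm j k ## s)|) =
      l1_influence f (tperm j (s^-1%g k)).
    rewrite /l1_influence.
    rewrite -(uexpect_perm (fun u => `|f u - f (u ## tperm j (s^-1%g k))|) s); apply: eq_uexpect => u.
    by rewrite -multislice_permM conjgCV multislice_permM tpermJ sj.
  apply: le_trans (l1_influence_tperm_le _ _ _) _.
  have : coord_influence f (s^-1%g k) <= coord_influence f j.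
    apply: jmax; rewrite -(Sym_closed (S := S) (s := s)) ?permKV //.
    exact: (subsetP (SymS (subsetDl S [set j]))).
  lra.
set c := _ * (3 * _).
have -> : \sum_(k in S) \sum_(s in Sym (S :\ j)) c = #|S|%:R * (#|Sym (S :\ j)|%:R * c).
  by rewrite !sumr_const [RHS]mulr_natl mulr_natl.
rewrite /c.
rewrite le_eqVlt; apply/orP; left; apply/eqP.
by field; rewrite !gt_eqF.
Qed.

(** Positions are peeled off [S] one at a time. Each difference [symavg (S :\ j) f - symavg S f]
    satisfies both the hypothesis and [entropy_sqr_ge], and its squared norm and Dirichlet form
    telescope. *)
Lemma log_variance_le S f (B t : R) : 0 < t ->
  (forall g, uexpect (fun v => g v ^+ 2 * ln (g v ^+ 2))
    - uexpect (fun v => g v ^+ 2) * ln (uexpect (fun v => g v ^+ 2))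
    <= B * dirichlet g) ->
  (0 < #|{: X}|)%N ->
  (1 + ln t) * uexpect (fun u => (f u - symavg S f u) ^+ 2)
    - 9 * t * \sum_(j in S) coord_influence f j ^+ 2
  <= B * (dirichlet f - dirichlet (symavg S f)).
Proof.
move=> t0 lsi X0.
have D0 : dirichlet f = dirichlet (symavg set0 f).
  rewrite /dirichlet; apply: eq_bigr => a _; apply: eq_bigr => b _.
  by apply: eq_uexpect => u; rewrite /sqdiff !symavg_set0.
have -> : uexpect (fun u => (f u - symavg S f u) ^+ 2) =
    uexpect (fun u => f u * symavg set0 f u) - uexpect (fun u => f u * symavg S f u).
  rewrite -(uexpect_sqr_symavgB _ (sub0set S)); apply: eq_uexpect => u.
  by rewrite symavg_set0.
rewrite D0; move: {2}#|S| (leqnn #|S|) => m.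
elim: m S => [|m IH] S.
  rewrite leqn0 cards_eq0 => /eqP->; rewrite big_set0 !subrr !mulr0 subr0.
  exact: lexx.
move=> cS; have [->|[j0 j0S]] := set_0Vmem S.
  rewrite big_set0 !subrr !mulr0 subr0; exact: lexx.
(* The largest influence in [S] is what [uexpect_norm_martingale_le] asks for. *)
case: (arg_maxP (coord_influence f) j0S) => j jS' jmax.
have jS : j \in S := jS'.
have cSj : (#|S :\ j| <= m)%N by move: cS; rewrite (cardsD1 j S) jS.
have {IH} := IH _ cSj.
have sub := subsetDl S [set j].
have := lsi (fun u => symavg (S :\ j) f u - symavg S f u).
have := entropy_sqr_ge (fun u => symavg (S :\ j) f u - symavg S f u) X0 t0.
rewrite (dirichlet_symavgB _ sub) (uexpect_sqr_symavgB _ sub).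
have b2 : t * uexpect (fun u => `|symavg (S :\ j) f u - symavg S f u|) ^+ 2 <=
    9 * t * coord_influence f j ^+ 2.
  rewrite [9 * t]mulrC -mulrA ler_pM2l //.
  have -> : 9 * coord_influence f j ^+ 2 = (3 * coord_influence f j) ^+ 2 by ring.
  apply: lerXn2r; rewrite ?nnegrE ?uexpect_ge0 //; last exact: uexpect_norm_martingale_le.
  by apply: mulr_ge0 => //; exact: coord_influence_ge0.
rewrite [\sum_(_ in S) _](big_setD1 j jS) /=.
move: b2; lra.
Qed.

End MartingaleDecomposition.

(** * Counting transpositions, rounding, and the choice of constants *)

Lemma sum_tperm_le (R : realType) (n : nat) (W : 'S_n -> R) :
  (forall s, 0 <= W s) -> W 1%g = 0 ->
  \sum_a \sum_b W (tperm a b) <= 2 * \sum_(s in transpositions n) W s.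
Proof.
move=> W0 W1; rewrite pair_big /=.
rewrite (bigID (fun p : 'I_n * 'I_n => p.1 == p.2)) /= big1 ?add0r; last first.
  by move=> [a b] /= /eqP->; rewrite tperm1.
rewrite (partition_big (fun p : 'I_n * 'I_n => tperm p.1 p.2) (mem (transpositions n))) /=; last first.
  move=> [a b] /= ab; rewrite inE; apply/existsP; exists a.
  by apply/existsP; exists b; rewrite ab eqxx.
rewrite mulr_sumr; apply: ler_sum => s.
rewrite inE => /existsP[i /existsP[j /andP[ij /eqP sij]]].
rewrite (eq_bigr (fun=> W s)) => [|p /andP[_ /eqP->]] //.
rewrite sumr_const mulr_natl ler_wpMn2l //.
(* A transposition arises only from the two orderings of its support. *)
apply: (@leq_trans #|[set (i, j); (j, i)]|); last by rewrite cards2; case: (_ != _).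
apply/subset_leq_card/subsetP => -[a b]; rewrite !inE /= => /andP[ab /eqP tab].
have := tpermL a b; rewrite tab sij; case: tpermP => [-> <-|-> <-|_ _ ba].
- by rewrite eqxx.
- by rewrite eqxx orbT.
by rewrite ba eqxx in ab.
Qed.

Lemma ln_inv_prod (R : realType) (I : finType) (p : I -> R) :
  (forall i, 0 < p i) -> ln (1 / \prod_i p i) = \sum_i ln (p i)^-1.
Proof.
move=> p0; rewrite -[RHS]expRK; congr ln; rewrite expR_sum div1r -prodfV.
by apply: eq_bigr => i _; rewrite lnK // posrE invr_gt0.
Qed.

Lemma uexpect_sqr_bool (R : realType) (T : finType) (f : T -> bool) (g : T -> T) :
  uexpect (fun u => `|(f u)%:R - (f (g u))%:R : R|) =
  uexpect (fun u => ((f u)%:R - (f (g u))%:R : R) ^+ 2).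
Proof.
rewrite /uexpect; congr (_ / _); apply: eq_bigr => u _.
case: (f u) (f (g u)) => [] [];
  by rewrite ?subrr ?subr0 ?sub0r ?normrN ?normr0 ?normr1 ?sqrrN ?expr0n ?expr1n.
Qed.

(** Round the average at 1/2: wherever this changes the value of [f], the average is at distance at
    least 1/2 from [f], whence the factor 4. Invariance under [Sym S] makes the rounding depend on
    the complement of [S]. *)
Lemma junta_of_symavg (R : realType) (n l : nat) (kappa : 'I_l -> nat)
    (f : multislice n kappa -> bool) (S : {set 'I_n}) :
  exists2 h : multislice n kappa -> bool,
    (forall u v : multislice n kappa, (forall j, j \in ~: S -> val u j = val v j) -> h u = h v) &
    uprob R (fun u => f u != h u) <=
    4 * uexpect (fun u => ((f u)%:R - symavg S (fun v => (f v)%:R : R) u) ^+ 2).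
Proof.
exists (fun u => 2^-1 < symavg S (fun v => (f v)%:R : R) u).
  move=> u v uv; have [x xS|s sS ->] := @multislice_transitive n l kappa S u v.
    by apply: uv; rewrite inE.
  by rewrite (symavg_perm _ _ sS).
rewrite /uprob -uexpectZ; apply: ler_uexpect => u.
move: (symavg _ _ _) => y.
have [y1|y1] := ltP 2^-1 y; case: (f u) => /=.
- by rewrite mulr_ge0 // sqr_ge0.
- have := sqr_ge0 (y - 2^-1); lra.
- have := sqr_ge0 (y - 2^-1); lra.
by rewrite mulr_ge0 // sqr_ge0.
Qed.

Theorem theorem4p25 (R : realType) :
  exists2 C : R, 0 < C &
    forall (l n : nat) (kappa : 'I_l -> nat),
      (2 <= l)%N ->
      (forall i, 0 < kappa i)%N ->
      (\sum_(i < l) kappa i)%N = n ->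
      let p := fun i : 'I_l => (kappa i)%:R / n%:R : R in
      forall (f : multislice n kappa -> bool) (K : R),
        total_influence (fun u => (f u)%:R : R) <= K * n%:R ->
        forall eps : R, 0 < eps ->
          exists2 h : multislice n kappa -> bool,
            depends_on_at_most h ((1 / \prod_(i < l) p i) `^ (C * K / eps)) &
            uprob R (fun u => f u != h u) <= eps.
Proof.
(* [596 = 144 + 452]: the exponent [452 * x] comes from [t], and [144 * x] absorbs the factor of [t]
   in the count of positions. *)
exists 596 => // l n kappa l2 kappa0 kappaE p f K hK eps eps0.
(* A constant suffices in these cases; over an empty type [uexpect] divides by 0, which gives 0. *)
have trivial_junta : 1 <= eps \/ #|{: multislice n kappa}| = 0%N ->
  exists2 h : multislice n kappa -> bool,
    depends_on_at_most h ((1 / \prod_(i < l) p i) `^ (596 * K / eps)) &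
    uprob R (fun u => f u != h u) <= eps.
  move=> triv; exists (fun=> false); first by exists set0; rewrite ?cards0 ?powR_ge0.
  case: triv => [e1|X0]; last first.
    by rewrite /uprob /uexpect X0 invr0 mulr0 ltW.
  apply: le_trans e1; rewrite /uprob /uexpect.
  have [->|X0] := posnP #|{: multislice n kappa}|; first by rewrite invr0 mulr0.
  rewrite ler_pdivrMr ?ltr0n // mul1r -sum1_card natr_sum ler_sum // => u _.
  by case: (_ != _).
have [e1|e1] := lerP 1 eps; first by apply: trivial_junta; left.
have [X0|X0] := posnP #|{: multislice n kappa}|; first by apply: trivial_junta; right.
have /card_gt0P[u0 _] := X0.
have l0 : (0 < l)%N by exact: leq_trans l2.
have n0 : (0 < n)%N.
  by rewrite -kappaE (bigD1 (Ordinal l0)) //= addn_gt0 kappa0.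
have N0 : (0 : R) < n%:R by rewrite ltr0n.
have p0 i : 0 < p i by rewrite divr_gt0 ?ltr0n.
set Lam := ln (1 / \prod_(i < l) p i).
have LamE : Lam = log_inv_freq R [set: 'I_n] u0.
  rewrite /Lam ln_inv_prod // /log_inv_freq; apply: eq_bigr => i _.
  by rewrite color_count_setT cardsT card_ord (maxn_idPr (kappa0 i)) /p invf_div.
(* From [ln (1 / p i) >= 1 - p i], as the [p i] add up to 1. With [l >= 2] this gives
   [l <= 2 * Lam], so [4 * (3 * l + Lam) <= 28 * Lam] in the log-Sobolev constant. *)
have Lam_ge : l%:R - 1 <= Lam.
  rewrite /Lam ln_inv_prod //.
  have -> : l%:R - 1 = \sum_(i < l) (1 - p i).
    rewrite sumrB sumr_const card_ord; congr (_ - _).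
    by rewrite /p -mulr_suml -natr_sum kappaE divff ?gt_eqF.
  apply: ler_sum => i _; rewrite -[X in 1 - X]invrK; apply: ln_ge_1subV.
  by rewrite invr_gt0.
have l2R : (2 : R) <= l%:R by rewrite ler_nat.
have Lam1 : 1 <= Lam by lra.
have powE : (1 / \prod_(i < l) p i) `^ (596 * K / eps) = expR (596 * (Lam * K / eps)).
  rewrite /powR gt_eqF; last by rewrite div1r invr_gt0 prodr_gt0.
  by rewrite -/Lam; congr expR; ring.
pose F u : R := (f u)%:R.
(* One factor 2 comes from ordered pairs, the other from the 1/2 in [influence]. *)
have D_le : dirichlet F <= 4 * K * n%:R.
  pose W s := uexpect (fun u => (F u - F (multislice_perm u s)) ^+ 2).
  have W0 s : 0 <= W s by apply: uexpect_ge0 => u; exact: sqr_ge0.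
  have W1 : W 1%g = 0.
    rewrite /W /uexpect big1 ?mul0r // => u _.
    by rewrite multislice_perm1 subrr expr0n.
  apply: le_trans (sum_tperm_le W0 W1) _.
  by move: hK; rewrite /total_influence /influence -mulr_sumr -/W; lra.
have I_sum : \sum_j coord_influence F j <= 4 * K.
  rewrite /coord_influence -mulr_suml ler_pdivrMr //.
  apply: le_trans D_le; rewrite /dirichlet; apply: ler_sum => a _; apply: ler_sum => b _.
  by rewrite /l1_influence /F uexpect_sqr_bool.
have K0 : 0 <= K.
  have : 0 <= \sum_j coord_influence F j.
    by apply: sumr_ge0 => j _; exact: coord_influence_ge0.
  lra.
set x := Lam * K / eps.
have x0 : 0 <= x by rewrite divr_ge0 ?(ltW eps0) // mulr_ge0 //; lra.
have xE : Lam * K = x * eps by rewrite /x divfK ?gt_eqF.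
set t := expR (452 * x).
have t0 : 0 < t by exact: expR_gt0.
(* The threshold for small influence, chosen so that [9 * t * (d * (4 * K)) = K]. *)
pose d : R := (36 * t)^-1.
have d0 : 0 < d by rewrite invr_gt0 mulr_gt0.
pose S := [set j | coord_influence F j <= d].
have [h hJ h_le] := junta_of_symavg R f S.
have lsi g : uexpect (fun v => g v ^+ 2 * ln (g v ^+ 2))
    - uexpect (fun v => g v ^+ 2) * ln (uexpect (fun v => g v ^+ 2))
    <= 28 * Lam / n%:R * @dirichlet R n l kappa g.
  apply: le_trans (uexpect_log_sobolev g u0 l0 n0) _; rewrite -LamE.
  rewrite ler_wpM2r ?dirichlet_ge0 // ler_wpM2r ?invr_ge0 ?ler0n //; lra.
have := log_variance_le S F t0 lsi X0; rewrite expRK.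
set A := uexpect _ => var_le.
have A_le : 4 * A <= eps.
  have I2 : 9 * t * \sum_(j in S) coord_influence F j ^+ 2 <= K.
    apply: (@le_trans _ _ (9 * t * (d * (4 * K)))).
      rewrite ler_wpM2l ?mulr_ge0 ?(ltW t0) //.
      apply: (@le_trans _ _ (\sum_(j in S) d * coord_influence F j)).
        apply: ler_sum => j; rewrite inE => jd; rewrite expr2 ler_wpM2r //.
        exact: coord_influence_ge0.
      rewrite -mulr_sumr ler_wpM2l ?(ltW d0) //; apply: le_trans I_sum.
      rewrite [leRHS](bigID (mem S)) /= lerDl sumr_ge0 // => j _.
      exact: coord_influence_ge0.
    rewrite le_eqVlt; apply/orP; left; apply/eqP; rewrite /d.
    by field; rewrite gt_eqF.
  have rhs : 28 * Lam / n%:R * (dirichlet F - dirichlet (symavg S F)) <= 112 * (Lam * K).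
    apply: (@le_trans _ _ (28 * Lam / n%:R * (4 * K * n%:R))).
      rewrite ler_wpM2l ?divr_ge0 ?mulr_ge0 ?ler0n //; first lra.
      by apply: le_trans D_le; rewrite lerBlDr lerDl dirichlet_ge0.
    rewrite le_eqVlt; apply/orP; left; apply/eqP.
    by field; rewrite gt_eqF.
  have KLam : K <= Lam * K by rewrite ler_peMl.
  have : (1 + 452 * x) * A <= 113 * (x * eps) by rewrite -xE; lra.
  (* As [452 = 4 * 113], if [4 * A > eps] then [452 * x * A] already reaches [113 * (x * eps)], and
     the remaining [A > 0] breaks the bound. *)
  apply: contraTT; rewrite -!ltNge => A_gt.
  have : 0 <= x * (4 * A - eps) by rewrite mulr_ge0 // subr_ge0 ltW.
  lra.
exists h; last by apply: le_trans h_le A_le.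
exists (~: S) => //; rewrite powE -/x.
(* Markov's inequality: each position outside [S] has influence above [d]. *)
have cJ : #|~: S|%:R * d <= 4 * K.
  apply: le_trans I_sum; rewrite [leRHS](bigID (mem S)) /=.
  apply: (@le_trans _ _ (\sum_(j | j \notin S) d)).
    rewrite (eq_bigl (fun j => j \in ~: S)) => [|j]; last by rewrite in_setC.
    by rewrite sumr_const mulr_natl.
  apply: (@le_trans _ _ (\sum_(j | j \notin S) coord_influence F j)).
    by apply: ler_sum => j; rewrite inE -ltNge => /ltW.
  by rewrite lerDr sumr_ge0 // => j _; exact: coord_influence_ge0.
(* Here [Lam >= 1] and [eps < 1] are used; the count [144 * K * t] then becomes at most
   [144 * x * t]. *)
have Kx : K <= x.
  have : K <= Lam * K by rewrite ler_peMl.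
  by rewrite xE => /le_trans; apply; rewrite ler_piMr // ltW.
have -> : 596 * x = 144 * x + 452 * x by lra.
rewrite expRD -/t.
apply: (@le_trans _ _ (144 * x * t)); last first.
  rewrite ler_wpM2r ?(ltW t0) //.
  by have := expR_ge1Dx (144 * x); lra.
have : #|~: S|%:R * d * (36 * t) <= 4 * K * (36 * t).
  by rewrite ler_wpM2r // mulr_ge0 // ltW.
rewrite /d mulfVK ?gt_eqF ?mulr_gt0 // => /le_trans; apply.
have : K * t <= x * t by rewrite ler_wpM2r // ltW.
lra.
Qed.
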